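(* Let $w\geq 4$ be an integer and let $C_2(w)=\{(x,y)\in\mathbb{R}^2: (x+y-1)^2=wxy\}$. A point $(x,y)\in C_2(w)$ has positive integer coordinates if and only if $(x,y)=(u_{n+1}(w),u_n(w))$ or $(x,y)=(u_n(w),u_{n+1}(w))$ for some integer $n\geq 1$.
   Context: The sequence $(u_n(w))_{n\geq0}$ is defined by $u_0(w)=0$, $u_1(w)=1$, and $u_{n+1}(w)=(w-2)u_n(w)-u_{n-1}(w)+2$ for $n\geq 1$ (so $u_2(w)=w$). *)

(* Defs.v *)
From HB Require Import structures.
From mathcomp Require Import all_boot all_order all_algebra.
From mathcomp Require Import classical_sets reals.

Set Implicit Arguments.
Unset Strict Implicit.
Unset Printing Implicit Defensive.

Import Order.TTheory GRing.Theory Num.Theory.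
Local Open Scope classical_set_scope.
Local Open Scope ring_scope.

Fixpoint u (w : int) (n : nat) : int :=
  match n with
  | 0%N => 0
  | 1%N => 1
  | (k.+1 as m).+1 => (w - 2) * u w m - u w k + 2
  end.

Definition C2 (R : realType) (w : int) : set (R * R) :=
  [set p | (p.1 + p.2 - 1) ^+ 2 = w%:~R * p.1 * p.2].

Definition pos_int_coords (R : realType) (p : R * R) : Prop :=
  (0 < p.1 /\ p.1 \is a Num.int) /\ (0 < p.2 /\ p.2 \is a Num.int).

(* Main.v *)
(** The curve is a quadratic in each coordinate.  If [a > b > 1] are integer
    coordinates, Vieta jumping replaces [a] by the other root
    [(w - 2) b - a + 2 = (b - 1)^2 / a], which lies strictly between [0] and
    [b].  The descent stops at [b = 1], where [a = w]; read backwards it is the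
    recurrence defining [u]. *)
Require Import Defs.
From mathcomp Require Import all_boot all_order all_algebra.
From mathcomp Require Import classical_sets reals.
From mathcomp Require Import zify ring.

Import Order.TTheory GRing.Theory Num.Theory.
Local Open Scope classical_set_scope.
Local Open Scope ring_scope.

Lemma u_rec (w : int) (n : nat) : u w n.+2 = (w - 2) * u w n.+1 - u w n + 2.
Proof. by []. Qed.

(** The next increment is [(w - 3) * u w n.+1 - u w n + 2]. Since [w - 3 >= 1] and [u w n.+1 >= 0],
    it exceeds the previous increment; this is why nonnegativity is carried through the
    induction. *)
Lemma u_ge0_lt (w : int) (hw : 4 <= w) (n : nat) : 0 <= u w n < u w n.+1.
Proof.
elim: n => [//|n IHn]; rewrite u_rec; nia.
Qed.

Lemma u_gt0 (w : int) (hw : 4 <= w) (n : nat) : (1 <= n)%N -> 0 < u w n.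
Proof. by case: n => // n _; have := u_ge0_lt w hw n; lia. Qed.

Lemma curve_descent (w a b : int) :
  0 < b -> b < a -> (a + b - 1) ^+ 2 = w * a * b ->
  exists n : nat, [/\ (1 <= n)%N, a = u w n.+1 & b = u w n].
Proof.
have [k] := ubnP `|b|%N; elim: k a b => // k IHk a b lt_bk b_gt0 lt_ba eq_ab.
have [b1|b_neq1] := eqVneq b 1.
  exists 1%N; split=> //; rewrite u_rec /=.
  have a_neq0 : a != 0 by lia.
  by apply: (mulfI a_neq0); move: eq_ab; rewrite b1 expr2; nia.
pose c := (w - 2) * b - a + 2.
have eq_ac : a * c = (b - 1) ^+ 2.
  (* Adding the difference of the two sides of [eq_ab], which is zero, turns Vieta's product formula
     into a polynomial identity. *)
  transitivity ((b - 1) ^+ 2 + (w * a * b - (a + b - 1) ^+ 2)).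
    by rewrite /c; ring.
  by rewrite eq_ab subrr addr0.
have eq_bc : (b + c - 1) ^+ 2 = w * b * c.
  transitivity (w * b * c + ((b - 1) ^+ 2 - a * c)); first by rewrite /c; ring.
  by rewrite eq_ac subrr addr0.
(* As [b != 1], the product [a * c] is positive. If [c >= b], then [a * c > b ^+ 2 > (b - 1) ^+ 2],
   a contradiction. *)
have c_gt0 : 0 < c by rewrite expr2 in eq_ac; clearbody c; nia.
have lt_cb : c < b by rewrite expr2 in eq_ac; clearbody c; nia.
have [|n [n_gt0 eq_b eq_c]] := IHk b c _ c_gt0 lt_cb eq_bc; first by lia.
by exists n.+1; split=> //; rewrite u_rec -eq_b -eq_c /c; ring.
Qed.

(** Here [(2 * a - 1) ^+ 2 < 4 * a ^+ 2 <= w * a ^+ 2]. *)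
Lemma curve_diag (w a : int) :
  4 <= w -> 0 < a -> (a + a - 1) ^+ 2 <> w * a * a.
Proof. by move=> hw a_gt0; rewrite expr2; nia. Qed.

Theorem theorem2 (R : realType) (w : int) (hw : 4 <= w)
    (x y : R) (hxy : C2 w (x, y)) :
  pos_int_coords (x, y) <->
  exists n : nat, (1 <= n)%N /\
    ((x, y) = ((u w n.+1)%:~R, (u w n)%:~R) \/
     (x, y) = ((u w n)%:~R, (u w n.+1)%:~R)).
Proof.
split; last first.
  move=> [n [n_gt0 eq_xy]].
  have un_gt0 := u_gt0 w hw n n_gt0; have un1_gt0 := u_gt0 w hw n.+1 isT.
  by case: eq_xy => -[-> ->]; split; split; rewrite ?intr_int ?ltr0z.
move=> [/= [x_gt0 /intrP[a def_x]] [y_gt0 /intrP[b def_y]]].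
move: hxy x_gt0 y_gt0; rewrite /C2 /= def_x def_y !ltr0z => eqR a_gt0 b_gt0.
have {eqR} eq_ab : (a + b - 1) ^+ 2 = w * a * b.
  by apply: (@intr_inj R); rewrite rmorphXn rmorphB rmorphD !rmorphM.
(* The equation is symmetric in [a] and [b], so the descent starts from whichever is larger. *)
have [lt_ab|lt_ba|a_b] := ltgtP a b.
- have [|n [n_gt0 -> ->]] := curve_descent w b a a_gt0 lt_ab.
    by rewrite (addrC b) eq_ab; ring.
  by exists n; split=> //; right.
- have [n [n_gt0 -> ->]] := curve_descent w a b b_gt0 lt_ba eq_ab.
  by exists n; split=> //; left.
- by move: eq_ab; rewrite -a_b => /(curve_diag w a hw a_gt0).
Qed.
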